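(* Consider the problem $$\max\ f_0(x)\quad\text{s.t.}\quad x_i\le f_i(x)\ \ \forall i\in\mathbb A,\qquad x_i=f_i(x)\ \ \forall i\in\mathbb B, \qquad (P)$$ with data $f_0$, $f=(f_1,\dots,f_n)^T$, $\mathbb A$, $\mathbb B$ and bounding box $\mathcal D$ as in the context. Assume that $(P)$ is feasible and that the General Qualifying Condition holds for every $x\in\mathcal D$. Then $(P)$ is Fast-Lipschitz, i.e., its unique Pareto optimal solution is given by $x^\star=f(x^\star)$.
   Context: Problem data: $f_0:\mathbb R^n\to\mathbb R^m$ ($m\ge1$) is differentiable; $f_i:\mathbb R^n\to\mathbb R$ ($i=1,\dots,n$) are differentiable and $f(x)=(f_1(x),\dots,f_n(x))^T$; $\mathbb A,\mathbb B$ are complementary subsets of $\{1,\dots,n\}$. A problem of the form $(P)$ is said to be in Fast-Lipschitz form. Notation: all inequalities between vectors or matrices are element-wise. The gradient is the transposed Jacobian: $[\nabla f(x)]_{ij}=\partial f_j(x)/\partial x_i$, and similarly for $f_0$ (so $\nabla f_0(x)\in\mathbb R^{n\times m}$). $\nabla f(x)^k$ is the $k$-th matrix power of $\nabla f(x)$. $\|A\|_\infty=\max_i\sum_j|A_{ij}|$. Pareto optimality: maximization is with respect to the non-negative orthant of $\mathbb R^m$; a feasible $\hat x$ is Pareto optimal if there is no other feasible $x$ with $f_0(x)\ge f_0(\hat x)$. Bounding box: $\mathcal D=\{x\in\mathbb R^n: a\le x\le b\}$ with $a,b\in\mathbb R^n$. Standing assumptions: $f(\mathcal D)\subseteq\mathcal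 D$, and $\mathcal D$ contains all candidates for optimality, i.e., for every weight vector $\mu\in\mathbb R^m$ with $\mu>0$ the maximum of $\mu^Tf_0(x)$ over the feasible set is attained and every maximizer lies in $\mathcal D$. Fast-Lipschitz: a problem in Fast-Lipschitz form is Fast-Lipschitz if it admits a unique Pareto optimal solution $x^\star$, which is the unique solution (in $\mathcal D$) of $x=f(x)$. General Qualifying Condition (at $x$): let $q(x)=\min_j \frac{\min_i[\nabla f_0(x)]_{ij}}{\max_i[\nabla f_0(x)]_{ij}}$. (a) $\nabla f_0(x)\ge 0$ and every row of $\nabla f_0(x)$ is non-zero; (b) $\|\nabla f(x)\|<1$, where $\|\cdot\|$ is some (sub-multiplicative) matrix norm, the same for all $x\in\mathcal D$; and there exists $k\in\{1,2,\dots\}\cup\{\infty\}$ such that (c) if $k<\infty$, then $\nabla f(x)^k\ge0$; (d) if $k>1$, then $\left\|\sum_{l=1}^{k-1}\nabla f(x)^l\right\|_\infty<q(x)$. *)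

(* Defs.v *)
From HB Require Import structures.
From mathcomp Require Import all_boot all_order all_algebra.
From mathcomp Require Import all_classical all_reals all_analysis.

Set Implicit Arguments.
Unset Strict Implicit.
Unset Printing Implicit Defensive.

Import Order.TTheory GRing.Theory Num.Theory.
Import numFieldNormedType.Exports.

Local Open Scope classical_set_scope.
Local Open Scope ring_scope.

Section Matrices.
Variable R : realType.

Definition mxle (p q : nat) (A B : 'M[R]_(p, q)) : Prop :=
  forall i j, A i j <= B i j.

Definition mxlt (p q : nat) (A B : 'M[R]_(p, q)) : Prop :=
  forall i j, A i j < B i j.

Definition norm_inf (p q : nat) (A : 'M[R]_(p, q)) : R :=
  \big[Num.max/0]_(i < p) \sum_(j < q) `|A i j|.

Record submultiplicative_norm (n : nat) (N : 'M[R]_n -> R) : Prop := {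
  smn_ge0 : forall A, 0 <= N A ;
  smn_eq0 : forall A, N A = 0 -> A = 0 ;
  smn_scale : forall c A, N (c *: A) = `|c| * N A ;
  smn_triangle : forall A B, N (A + B) <= N A + N B ;
  smn_mul : forall A B, N (A *m B) <= N A * N B }.

(* The transposed Jacobian. The library's ['J f x] acts on row vectors by
   [v *m 'J f x], so it is already this transpose: see [gradientE]. *)
Definition gradient (n m : nat) (f : 'rV[R]_n -> 'rV[R]_m) (x : 'rV[R]_n) :
    'M[R]_(n, m) :=
  \matrix_(i, j) 'D_(delta_mx 0 i) (fun y => f y 0 j) x.

(* Vectors and matrices are over 'I_n.+1 and 'I_m.+1, so that minima and maxima
   over rows or columns are over nonempty sets; the ord0 entry used to
   initialise each of them is one of the entries it ranges over. *)
Definition col_min (n m : nat) (G : 'M[R]_(n.+1, m)) (j : 'I_m) : R :=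
  \big[Num.min/G ord0 j]_i G i j.

Definition col_max (n m : nat) (G : 'M[R]_(n.+1, m)) (j : 'I_m) : R :=
  \big[Num.max/G ord0 j]_i G i j.

(* A zero column of a nonnegative G contributes the ratio 0 / 0 = 0: then
   [min_ratio G] is at most 0 and no norm is strictly below it. *)
Definition min_ratio (n m : nat) (G : 'M[R]_(n.+1, m.+1)) : R :=
  let r j := col_min G j / col_max G j in
  \big[Num.min/r ord0]_j r j.

(* Exponents in {0, 1, 2, ...} U {oo} are encoded as [option nat], with [None]
   for oo. *)
Definition xleq (p : nat) (k : option nat) : bool :=
  if k is Some k' then (p <= k')%N else true.

Definition power_sum (n : nat) (A : 'M[R]_n.+1) (k : option nat) :
    'M[R]_n.+1 :=
  match k with
  | Some k => \sum_(1 <= l < k) A ^+ l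
  | None => limn (fun K : nat => \sum_(1 <= l < K) A ^+ l)
  end.

End Matrices.

Lemma gradientE (R : realType) (n m : nat) (f : 'rV[R]_n -> 'rV[R]_m)
    (x : 'rV[R]_n) :
  differentiable f x -> gradient f x = 'J f x.
Proof.
move=> fx; apply/row_matrixP => i.
rewrite [RHS]rowE -deriveEjacobian// derive_mx; last exact: diff_derivable.
by apply/rowP => j; rewrite !mxE.
Qed.

Section FastLipschitz.
Variables (R : realType) (n m : nat).
Variables (f0 : 'rV[R]_n.+1 -> 'rV[R]_m.+1).
Variables (f : 'rV[R]_n.+1 -> 'rV[R]_n.+1).
Variables (A B : {set 'I_n.+1}) (a b : 'rV[R]_n.+1).

Definition feasible : set 'rV[R]_n.+1 :=
  [set x : 'rV[R]_n.+1 | (forall i, i \in A -> x 0 i <= f x 0 i) /\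
    (forall i, i \in B -> x 0 i = f x 0 i)].

Definition box : set 'rV[R]_n.+1 := [set x : 'rV[R]_n.+1 | mxle a x /\ mxle x b].

Definition pareto_optimal (xh : 'rV[R]_n.+1) : Prop :=
  feasible xh /\
  ~ exists x, [/\ feasible x, x <> xh & mxle (f0 xh) (f0 x)].

Definition weighted_objective (mu : 'rV[R]_m.+1) (x : 'rV[R]_n.+1) : R :=
  \sum_j mu 0 j * f0 x 0 j.

Definition weighted_maximizer (mu : 'rV[R]_m.+1) (x : 'rV[R]_n.+1) : Prop :=
  feasible x /\
  forall y, feasible y -> weighted_objective mu y <= weighted_objective mu x.

Definition box_contains_candidates : Prop :=
  forall mu : 'rV[R]_m.+1, mxlt 0 mu ->
    (exists x, weighted_maximizer mu x) /\
    (forall x, weighted_maximizer mu x -> box x).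

Definition qualifying_condition (N : 'M[R]_n.+1 -> R) (x : 'rV[R]_n.+1) :
    Prop :=
  let G0 := gradient f0 x in
  let G := gradient f x in
  [/\ mxle 0 G0 /\ (forall i, row i G0 <> 0),
      N G < 1 &
      exists k : option nat,
        [/\ xleq 1 k,
            (forall k', k = Some k' -> mxle 0 (G ^+ k')) &
            (xleq 2 k -> norm_inf (power_sum G k) < min_ratio G0)]].

Definition fast_lipschitz : Prop :=
  exists xs,
    [/\ pareto_optimal xs,
        (forall x, pareto_optimal x -> x = xs),
        box xs /\ xs = f xs &
        (forall x, box x -> x = f x -> x = xs)].

End FastLipschitz.

(* Main.v *)
Require Import Defs.
From HB Require Import structures.
From mathcomp Require Import all_boot all_order all_fingroup all_algebra.
From mathcomp Require Import all_classical all_reals all_analysis.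
From mathcomp Require Import zify lra ring.

Set Implicit Arguments.
Unset Strict Implicit.
Unset Printing Implicit Defensive.

Import Order.TTheory GRing.Theory Num.Theory.
Import numFieldNormedType.Exports.
Local Open Scope classical_set_scope.
Local Open Scope ring_scope.

(** Fix a weight vector [mu > 0] and a maximizer [x] of the weighted objective
    over the feasible set; it lies in the box, so the qualifying condition holds
    at [x].  Write [G], [G0] for the gradients of [f], [f0] at [x], acting on
    row vectors from the right.  If constraint [i] had positive slack at [x],
    one could use up a little of it, all other slacks being unchanged, by moving
    in the direction [d] with [d (1 - G) = e_i].  The weighted objective then
    changes at the rate [d G0 mu^T = u_i], where [u = (1 - G)^-1 G0 mu^T] is the
    vector of Lagrange multipliers.  The qualifying condition makes
    all multipliers positive ([multiplier_pos]): with
    [S = G + ... + G^(k-1)], one has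
<<
      (1 - G)^-1 = (1 + G^k + G^2k + ...) (1 + S),
>>
    the first factor is nonnegative, and [(1 + S) G0] is positive since the
    entries of a column of [S G0] are at most [norm_inf S] times the greatest
    entry of that column of [G0], hence smaller than the least one.  (For [k]
    infinite the first factor is 1; for [k = 1] the second is 1, and
    [G0 mu^T > 0] because no row of [G0] is zero.)  So the move improves the
    objective, a contradiction: every weighted maximizer is a fixed point of [f]
    ([maximizer_fixed]).

    The move must keep the equality constraints exactly, and [f] is merely
    differentiable.  Moreover [x] may lie on the boundary of the box, outside of
    which nothing is known about the gradients, so that neither the inverse
    function theorem nor a contraction argument applies.  What is true is that a
    continuous map with invertible derivative at one point takes all nearby
    values, at points given to first order by the inverse derivative
    ([local_solvability]).  This is a topological fact; it is
    derived from the Poincare-Miranda theorem, which in turn comes from a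
    discrete version on a grid.  The discrete version is proved by computing a
    mod 2 degree: the sum, over the simplices of the Kuhn triangulation, of a
    cup product of coboundaries depends only on boundary values
    ([kuhn_sum_replace]), and it is 1 for the simplest labelling.

    In the box [f] has at most one fixed point ([fixed_point_unique]): [N]
    induces a vector norm for which all derivatives of [f] along a segment of
    the box are contractions.  Hence one and the same point [xs] maximizes the
    weighted objectives for all [mu > 0].  Letting one weight dominate shows
    that [f0 xs] dominates [f0 x] for each feasible [x]
    ([dominated_of_weighted]), so nothing else can be Pareto optimal; and a
    feasible [x] with [f0 xs <= f0 x] is itself a weighted maximizer, hence
    equal to [xs]. *)

(** * A mod 2 degree on the grid *)

Section KuhnSum.
Variables n p : nat.
Local Notation vtx := ('I_n.+1 -> nat).
Local Notation simplex := ({ffun 'I_n.+1 -> 'I_p.+1} * {perm 'I_n.+1})%type.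

(** A simplex of the Kuhn triangulation of the grid [{0..p+1}^(n+1)] is a cell
    [s.1] together with an order [s.2] in which the coordinates are raised, one
    at a time, from the lowest corner of the cell to the highest: [s.2 i] is the
    time at which coordinate [i] is raised, and [vertex s k] is the corner
    reached after [k] steps. *)
Definition vertex (s : simplex) (k : nat) : vtx :=
  fun i => (s.1 i + (s.2 i < k))%N.

Definition jump (h : vtx -> 'F_2) (s : simplex) (k : nat) : 'F_2 :=
  h (vertex s k.+1) - h (vertex s k).

(** Value on the sum of all simplices of the cup product
    [dg_0 U dg_1 U ... U dg_n] of the coboundaries of the labels.  It is the
    discrete, mod 2 analogue of the integral of the Jacobian determinant of
    [(g_0, ..., g_n)], and like that integral it depends on boundary values
    only. *)
Definition kuhn_sum (g : 'I_n.+1 -> vtx -> 'F_2) : 'F_2 :=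
  \sum_s \prod_k jump (g k) s k.

Definition admissible (g : 'I_n.+1 -> vtx -> 'F_2) : Prop :=
  forall i x, (x i = 0%N -> g i x = 0) /\ (x i = p.+1 -> g i x = 1).

Lemma addF2 (x : 'F_2) : x + x = 0.
Proof. by rewrite -mulr2n -mulr_natr pchar_Zp// mulr0. Qed.

Lemma oppF2 (x : 'F_2) : - x = x.
Proof. by apply/eqP; rewrite eq_sym -addr_eq0 addF2. Qed.

(** Exchanging steps [m] and [m.+1] yields the other simplex that contains all
    vertices of [s] but the one numbered [m.+1]. *)
Definition flip (m : nat) (s : simplex) : simplex :=
  (s.1, s.2 * tperm (inord m) (inord m.+1))%g.

Lemma vertex_flip m s k : (m < n)%N -> k != m.+1 ->
  vertex (flip m s) k = vertex s k.
Proof.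
move=> mn km; apply/funext => i; rewrite /vertex /= permM.
congr (_ + nat_of_bool _)%N.
have m1 : (m < n.+1)%N by apply: ltnW.
case: tpermP => [->|->|//]; rewrite !inordK ?ltnS//.
  by rewrite [RHS]leq_eqVlt eq_sym (negbTE km).
by rewrite [LHS]leq_eqVlt eq_sym (negbTE km).
Qed.

(** Inner faces cancel in pairs mod 2; [flip m] exchanges even and odd
    permutations, so it has no fixed point. *)
Lemma sum_flip0 m (Z : simplex -> 'F_2) : (m < n)%N ->
  (forall s, Z (flip m s) = Z s) -> \sum_s Z s = 0.
Proof.
move=> mn Zf; rewrite (bigID (fun s : simplex => odd_perm s.2)) /=.
rewrite [X in X + _](reindex_inj (h := flip m)) /=; last first.
  by apply: inv_inj => -[q t]; rewrite /flip /= -mulgA tperm2 mulg1.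
rewrite [X in X + _](eq_bigl (fun s : simplex => ~~ odd_perm s.2)); last first.
  move=> s; rewrite /flip /= odd_permM odd_tperm -val_eqE /= !inordK ?ltnS//; last exact: ltnW.
  by rewrite (ltn_eqF (ltnSn m)) addbT.
by under eq_bigr do rewrite Zf; exact: addF2.
Qed.

Section Shift.
Variables (u : vtx -> 'F_2) (gs : 'I_n -> vtx -> 'F_2).

(** Let one label be replaced, [u] being the difference of the two versions and
    [gs] the other labels.  [skip_sum m t] evaluates [u] at vertex [t] and the
    coboundaries of [gs] along the [n] edges of the path other than edge [m].
    When [t] is an end of edge [m], this is the contribution of one end of that
    edge to the change of [kuhn_sum]. *)
Definition skip_sum (m t : nat) : 'F_2 :=
  \sum_s u (vertex s t) * \prod_(k < n) jump (gs k) s (bump m k).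

(** Moving the skipped edge from [m] to [m.+1] shifts the coboundary of [gs m]
    from edge [m.+1] to edge [m].  The two differ by an increment over both
    edges, which does not see the vertex [m.+1] between them and so sums to
    zero. *)
Lemma skip_sumS m t : (m < n)%N -> t != m.+1 ->
  skip_sum m t = skip_sum m.+1 t.
Proof.
move=> mn tm; apply/eqP; rewrite -subr_eq0 -sumrB; apply/eqP.
pose o := Ordinal mn.
pose Z s := u (vertex s t) * ((gs o (vertex s m.+2) + gs o (vertex s m)) *
  \prod_(k < n | k != o) jump (gs k) s (bump m k)).
transitivity (\sum_s Z s).
  apply: eq_bigr => s _; rewrite -mulrBr; congr (_ * _).
  rewrite (bigD1 o) //= [X in _ - X](bigD1 o) //=.
  rewrite [X in _ - _ * X](eq_bigr (fun k : 'I_n => jump (gs k) s (bump m k))).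
    rewrite -mulrBl /bump leqnn ltnn /= add0n add1n /jump; congr (_ * _).
    by rewrite !oppF2 addrA -[X in X + _]addrA addF2 addr0.
  move=> k; rewrite -val_eqE /= => km; congr jump.
  by rewrite /bump (ltn_neqAle m) eq_sym km.
apply: (@sum_flip0 m) => // s; have [m1 m2] : m != m.+1 /\ m.+2 != m.+1 by lia.
rewrite /Z !vertex_flip//.
congr (_ * (_ * _)); apply: eq_bigr => k; rewrite -val_eqE /= => km.
rewrite /jump !vertex_flip//; rewrite /bump.
  by case: (ltngtP m k) km => //= mk _; rewrite ?add0n ?add1n; apply/eqP; lia.
by case: (ltngtP m k) km => //= mk _; rewrite ?add0n ?add1n; apply/eqP; lia.
Qed.

Lemma skip_sum_up j : (j <= n)%N -> skip_sum j j = skip_sum n j.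
Proof.
move=> jn; suff H d : (j + d <= n)%N -> skip_sum j j = skip_sum (j + d) j.
  by rewrite (H (n - j)%N) subnKC.
elim: d => [|d IH] h; first by rewrite addn0.
by rewrite addnS -skip_sumS -?IH//; lia.
Qed.

Lemma skip_sum_down j : (j <= n)%N -> skip_sum j j.+1 = skip_sum 0 j.+1.
Proof.
move=> jn; suff H d : (d <= j)%N -> skip_sum d j.+1 = skip_sum 0 j.+1.
  exact: H.
by elim: d => // d IH h; rewrite -skip_sumS ?IH//; lia.
Qed.

End Shift.

(** The simplex on the path that leaves out the first step of [s] and repeats
    it at the end: it meets [s] in the face opposite to the initial vertex.
    Cells are taken modulo [p.+1] to make this a bijection of the whole
    triangulation; on wrapping around, a face in [x i = p.+1] is replaced by the
    corresponding face in [x i = 0]. *)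
Definition rotate (s : simplex) : simplex :=
  ([ffun i => if s.2 i == ord0 then ordS (s.1 i) else s.1 i],
   s.2 * perm (@ord_pred_inj n.+1))%g.

Lemma rotate_inj : injective rotate.
Proof.
move=> [q t] [q' t'] [/ffunP eqq /mulIg eqt]; rewrite -{}eqt in eqq *.
congr (_, _); apply/ffunP => i; have := eqq i; rewrite !ffunE.
by case: ifP => // _ /ordS_inj.
Qed.

Lemma vertex_rotate (s : simplex) k : (k <= n)%N ->
  (forall i, s.2 i = ord0 -> (s.1 i < p)%N) ->
  vertex (rotate s) k = vertex s k.+1.
Proof.
move=> kn nowrap; apply/funext => i; rewrite /vertex /= ffunE permM permE /=.
case: eqP => [t0|/eqP].
  rewrite t0 /= (modn_small (ltnSn n)) (modn_small (nowrap i t0 : _.+1 < p.+1)%N).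
  by rewrite (leq_gtF kn) addn0 addn1.
rewrite -val_eqE /= -lt0n => t0; congr (_ + nat_of_bool _)%N.
rewrite [X in (X %% _)%N](_ : _ = (s.2 i).-1 + n.+1)%N; last lia.
by rewrite modnDr modn_small; have := ltn_ord (s.2 i); lia.
Qed.

Lemma admissible_face (g : 'I_n.+1 -> vtx -> 'F_2) i (x y : vtx) :
  admissible g -> x i = y i -> x i \in [:: 0%N; p.+1] -> g i x - g i y = 0.
Proof.
move=> adg eqv; have [gx0 gx1] := adg i x.
have [gy0 gy1] := adg i y; rewrite -eqv in gy0 gy1.
by rewrite !inE => /orP[]/eqP e; [rewrite gx0 ?gy0|rewrite gx1 ?gy1]; rewrite ?subrr.
Qed.

(** The face of [s] opposite to its initial vertex is the face of [rotate s]
    opposite to its final vertex, unless wrapping around separates the two.  In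
    that case both lie in the boundary and contribute nothing: in [x i = 0] or
    [x i = p.+1], the label [g i] is constant if it is among the remaining
    labels, and otherwise [u] vanishes. *)
Lemma skip_sum_rotate (g : 'I_n.+1 -> vtx -> 'F_2) u j : admissible g ->
  (forall x, x j \in [:: 0%N; p.+1] -> u x = 0) ->
  skip_sum u (fun k => g (lift j k)) 0 j.+1 =
  skip_sum u (fun k => g (lift j k)) n j.
Proof.
move=> adg u0; rewrite /skip_sum [RHS](reindex_inj rotate_inj).
apply: eq_bigr => s _.
have [nowrap|wrap] := pselect (forall i, s.2 i = ord0 -> (s.1 i < p)%N).
  rewrite vertex_rotate// -1?ltnS//; congr (_ * _); apply: eq_bigr => k _.
  rewrite /jump /bump leq0n leqNgt ltn_ord add0n add1n.
  by rewrite !vertex_rotate// ltnW.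
have {wrap}[i [ti qi]] : exists i, s.2 i = ord0 /\ s.1 i = p :> nat.
  apply: contrapT => h; apply: wrap => i ti; rewrite ltn_neqAle -ltnS ltn_ord andbT.
  by apply/eqP => qi; apply: h; exists i.
have last_face k : vertex s k.+1 i = p.+1 by rewrite /vertex ti qi /= addn1.
have first_face k : (k <= n)%N -> vertex (rotate s) k i = 0%N.
  move=> kn; rewrite /vertex /= ffunE permM permE ti eqxx /= qi modnn.
  by rewrite modn_small// ltnNge kn.
have [k ik|ij] := unliftP j i.
  rewrite (bigD1 k) //= [in RHS](bigD1 k) //= /jump /bump leq0n leqNgt ltn_ord.
  rewrite !add0n !add1n !(@admissible_face g (lift j k))// -?ik.
  - by rewrite !mul0r !mulr0.
  - by rewrite !first_face// ltnW.
  - by rewrite !first_face.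
  - by rewrite !last_face.
  - by rewrite last_face !inE eqxx orbT.
rewrite !u0 ?mul0r// -ij.
  by rewrite first_face// -ltnS.
by rewrite last_face !inE eqxx orbT.
Qed.

(** The change is a sum of two terms, one for each end of edge [j].  Pushing the
    skipped edge away from the vertex where [u] is evaluated, to the last edge
    for one end and to the first edge for the other, turns them into sums over
    the faces opposite to the final and initial vertices, which agree. *)
Lemma kuhn_sum_replace (g g' : 'I_n.+1 -> vtx -> 'F_2) j :
  admissible g -> admissible g' -> (forall i, i != j -> g i = g' i) ->
  kuhn_sum g = kuhn_sum g'.
Proof.
move=> adg adg' gg'; apply/eqP; rewrite -subr_eq0 -sumrB.
pose u x := g j x - g' j x; pose gs k := g (lift j k).
have u0 x : x j \in [:: 0%N; p.+1] -> u x = 0.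
  have [g0 g1] := adg j x; have [g0' g1'] := adg' j x.
  by rewrite !inE /u => /orP[]/eqP e; [rewrite g0 ?g0'|rewrite g1 ?g1']; rewrite ?subrr.
rewrite [X in X == _](_ : _ = skip_sum u gs j j.+1 + skip_sum u gs j j).
  have jn : (j <= n)%N by rewrite -ltnS.
  rewrite (skip_sum_down u gs jn) (skip_sum_up u gs jn).
  by rewrite (skip_sum_rotate adg u0) addF2.
rewrite -big_split /=; apply: eq_bigr => s _.
rewrite (bigD1_ord j)//= [X in _ - X](bigD1_ord j)//=.
rewrite [X in _ - _ * X](eq_bigr (fun k : 'I_n => jump (gs k) s (bump j k))).
  rewrite -mulrBl -mulrDl; congr (_ * _); rewrite /jump /u !oppF2.
  by rewrite addrACA.
by move=> k _; rewrite /gs gg'// eq_sym neq_lift.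
Qed.

Definition step (i : 'I_n.+1) (x : vtx) : 'F_2 := (0 < x i)%N%:R.

Lemma admissible_step : admissible step.
Proof. by move=> i x; split; rewrite /step => ->. Qed.

(** For the labels [0 < x i] only the simplex at the origin that raises the
    coordinates in their natural order has nonzero jumps. *)
Lemma kuhn_sum_step : kuhn_sum step = 1.
Proof.
rewrite /kuhn_sum (bigD1 ([ffun=> ord0], 1%g)) //= !big1 ?addr0//.
  move=> [q t] ne; apply/eqP; apply: contraR ne => /prodf_neq0 ne.
  have qt i : q i = ord0 /\ t i = i.
    have := ne i isT; rewrite /jump /step /vertex /= ltnS.
    have [q0|qN] := posnP (q i); last by rewrite !addn_gt0 qN subrr eqxx.
    have [ti|ti|ti _] := ltngtP (t i) i; rewrite ?q0 ?subrr ?eqxx//.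
    by split; apply: val_inj.
  apply/eqP; congr (_, _); first by apply/ffunP => i; rewrite ffunE; case: (qt i).
  by apply/permP => i; rewrite perm1; case: (qt i).
by move=> i _; rewrite /jump /step /vertex /= !ffunE perm1 leqnn ltnn subr0.
Qed.

Lemma kuhn_sum_admissible g : admissible g -> kuhn_sum g = 1.
Proof.
move=> adg; rewrite -kuhn_sum_step.
pose h m (i : 'I_n.+1) := if (i < m)%N then step i else g i.
have adh m : admissible (h m).
  by move=> i x; rewrite /h; case: ifP => _; [exact: admissible_step|exact: adg].
suff hE m : (m <= n.+1)%N -> kuhn_sum g = kuhn_sum (h m).
  rewrite (hE n.+1)//; congr kuhn_sum; apply/funext => i.
  by rewrite /h ltn_ord.
elim: m => [_|m IH mn]; first by congr kuhn_sum; apply/funext.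
rewrite IH 1?ltnW//; apply: (@kuhn_sum_replace _ _ (Ordinal mn)) => // i.
by rewrite -val_eqE /h /= => im; rewrite ltnS (ltn_neqAle i) im.
Qed.
End KuhnSum.

(** The sum being nonzero, some simplex contributes: along its path each label
    jumps once, between two corners of the same cell. *)
Lemma discrete_poincare_miranda (n p : nat)
    (l : 'I_n.+1 -> ('I_n.+1 -> nat) -> bool) :
  (forall i x, x i = 0%N -> l i x = false) ->
  (forall i x, x i = p.+1 -> l i x = true) ->
  exists q : 'I_n.+1 -> 'I_p.+1, forall i, exists x y,
    [/\ forall j, (q j <= x j <= (q j).+1)%N,
        forall j, (q j <= y j <= (q j).+1)%N, l i x = false & l i y = true].
Proof.
move=> l0 l1; pose g i x : 'F_2 := (l i x)%:R.
have adg : admissible p g.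
  by move=> i x; rewrite /g; split => [/l0->|/l1->].
have [s sN] : exists s : {ffun 'I_n.+1 -> 'I_p.+1} * {perm 'I_n.+1},
    \prod_k jump (g k) s k != 0.
  apply: contrapT => h; have /eqP := kuhn_sum_admissible adg.
  rewrite /kuhn_sum big1 => [|s _]; first by rewrite eq_sym oner_eq0.
  by apply/eqP; apply: contra_notT h => sN; exists s.
exists (fun i => s.1 i) => i.
move/prodf_neq0/(_ i isT): sN; rewrite /jump /g.
have cell k j : (s.1 j <= vertex s k j <= (s.1 j).+1)%N.
  by rewrite /vertex; case: (_ < _)%N; lia.
case e1: (l i (vertex s i.+1)); case e2: (l i (vertex s i)); rewrite ?subrr ?eqxx// => _.
- by exists (vertex s i), (vertex s i.+1).
- by exists (vertex s i.+1), (vertex s i).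
Qed.

(** * From the grid to the cube *)

Section MatrixSupNorm.
Variable R : realType.

Lemma entry_le_norm p q (M : 'M[R]_(p, q)) i j : `|M i j| <= `|M|.
Proof.
rewrite [leRHS]/Num.norm /= mx_normrE.
by apply/bigmax_geP; right => /=; exists (i, j).
Qed.

Lemma norm_le_entries p q (M : 'M[R]_(p, q)) c :
  0 <= c -> (forall i j, `|M i j| <= c) -> `|M| <= c.
Proof.
move=> c0 Mc; rewrite [leLHS]/Num.norm /= mx_normrE.
by apply/bigmax_leP; split => //= -[i j] _; exact: Mc.
Qed.

Lemma norm_mulmx p q r (M : 'M[R]_(p, q)) (L : 'M[R]_(q, r)) :
  `|M *m L| <= `|M| * (q%:R * `|L|).
Proof.
apply: norm_le_entries => [|i j]; first by rewrite !mulr_ge0.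
rewrite mxE (le_trans (ler_norm_sum _ _ _))// mulrCA.
rewrite mulr_natl -[X in _ *+ X]card_ord -sumr_const.
by apply: ler_sum => k _; rewrite normrM ler_pM// entry_le_norm.
Qed.

(** The first-order expansion with an explicit radius, in terms of the matrix
    that acts on row vectors from the right. *)
Lemma differentiable_expansion p q (g : 'rV[R]_p -> 'rV[R]_q) x e :
  differentiable g x -> 0 < e ->
  exists2 d, 0 < d & forall h, `|h| < d ->
    `|g (x + h) - g x - h *m 'J g x| <= e * `|h|.
Proof.
move=> dg e0; have /eqaddoP/(_ e e0) := diff_locally dg.
move=> /nbhs_norm0P[d /= d0 H]; exists d => // h hd.
rewrite mul_rV_lin1 -addrA -opprD [x + h]addrC; exact: H.
Qed.

End MatrixSupNorm.

(** The discrete theorem on a grid of mesh [2 c / (p + 1)], the label of a node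
    being the sign of [H] there.  Mixed strict and weak inequalities make the
    label a boolean with the right values on both faces. *)
Lemma fine_sign_changes (R : realType) (n : nat)
    (H : 'rV[R]_n.+1 -> 'rV[R]_n.+1) (c : R) (p : nat) : 0 < c ->
  (forall (x : 'rV[R]_n.+1) i, `|x| <= c -> x 0 i = - c -> H x 0 i <= 0) ->
  (forall (x : 'rV[R]_n.+1) i, `|x| <= c -> x 0 i = c -> 0 < H x 0 i) ->
  exists r : 'rV[R]_n.+1, `|r| <= c /\ forall i, exists x y,
    [/\ `|r - x| <= c *+ 2 / p.+1%:R, `|r - y| <= c *+ 2 / p.+1%:R,
        H x 0 i <= 0 & 0 < H y 0 i].
Proof.
move=> c0 Hlow Hhigh; pose mesh : R := c *+ 2 / p.+1%:R.
have mesh0 : 0 < mesh by rewrite divr_gt0// mulrn_wgt0.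
have meshp : mesh * p.+1%:R = c *+ 2 by rewrite divfK.
pose pt (v : 'I_n.+1 -> nat) : 'rV[R]_n.+1 :=
  (* Labels are defined on all vectors of naturals; clamping keeps the nodes in
     the cube and does not affect the grid itself. *)
  \row_i (- c + mesh * (minn (v i) p.+1)%:R).
have pt_cube v : `|pt v| <= c.
  apply: norm_le_entries => [|i j]; first exact: ltW.
  rewrite mxE ler_norml; set t := mesh * _.
  have t0 : 0 <= t by rewrite mulr_ge0// ltW.
  have : t <= c *+ 2 by rewrite -meshp ler_pM2l// ler_nat geq_minr.
  by rewrite mulr2n; lra.
pose l i v := 0 < H (pt v) 0 i.
have [|| q cell] := @discrete_poincare_miranda n p l.
- move=> i v vi; apply/negbTE; rewrite -leNgt; apply: Hlow => //.
  by rewrite mxE vi min0n mulr0 addr0.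
- move=> i v vi; apply: Hhigh => //.
  by rewrite mxE vi minnn meshp mulr2n addrA addNr add0r.
exists (pt (fun j => q j)); split=> // i; have [v [w [qv qw lv lw]]] := cell i.
have near_pt (u : 'I_n.+1 -> nat) : (forall j, (q j <= u j <= (q j).+1)%N) ->
    `|pt (fun j => q j) - pt u| <= mesh.
  move=> qu; apply: norm_le_entries => [|a j]; first exact: ltW.
  rewrite !mxE opprD addrACA subrr add0r -mulrBr normrM gtr0_norm//.
  rewrite ler_piMr ?(ltW mesh0)// distrC.
  have /andP[q1 q2] := qu j; have qp : (q j <= p.+1)%N by exact: ltnW.
  have up : (u j <= p.+1)%N by apply: leq_trans q2 _.
  rewrite (minn_idPl qp) (minn_idPl up) -(natrB _ q1) normr_nat.
  by rewrite -[leRHS]/(1%:R) ler_nat; lia.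
exists (pt v), (pt w); split; [exact: near_pt|exact: near_pt| |exact: lw].
by move/negbT: lv; rewrite -leNgt.
Qed.

(** A limit point of the cells found on finer and finer grids: both signs of
    each component occur arbitrarily near to it. *)
Lemma poincare_miranda (R : realType) (n : nat)
    (H : 'rV[R]_n.+1 -> 'rV[R]_n.+1) (c : R) : 0 < c -> continuous H ->
  (forall (x : 'rV[R]_n.+1) i, `|x| <= c -> x 0 i = - c -> H x 0 i <= 0) ->
  (forall (x : 'rV[R]_n.+1) i, `|x| <= c -> x 0 i = c -> 0 < H x 0 i) ->
  exists2 z : 'rV[R]_n.+1, `|z| <= c & H z = 0.
Proof.
move=> c0 Hc Hlow Hhigh.
pose cube := [set x : 'rV[R]_n.+1 | forall i, `[- c, c]%classic (x 0 i)].
have cube_compact : compact cube.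
  exact: (@rV_compact _ _ (fun=> `[- c, c]%classic)) (fun=> @segment_compact _ _ _).
have cubeE x : cube x <-> `|x| <= c.
  split=> [xc|xc i]; last first.
    by rewrite /= in_itv /= -ler_norml (le_trans (entry_le_norm _ _ _)).
  apply: norm_le_entries => [|a i]; first exact: ltW.
  by have := xc i; rewrite /= in_itv /= -ler_norml ord1.
have [r rP] := choice (fun p => fine_sign_changes p c0 Hlow Hhigh).
have [z [/cubeE zc clz]] : cube `&` cluster (r @ \oo) !=set0.
  by apply: cube_compact; exists 0%N => // p _; apply/cubeE; case: (rP p).
exists z => //; apply/rowP => i; rewrite mxE.
have approx e : 0 < e -> exists p,
    forall x, `|r p - x| <= c *+ 2 / p.+1%:R -> `|z - x| < e.
  move=> e0; have e4 : 0 < e / 2 / (c *+ 2) by rewrite !divr_gt0// mulrn_wgt0.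
  have [P _ meshP] := near_infty_natSinv_lt (PosNum e4).
  have [||_ [[p Pp <-] zp]] := clz [set r p | p in [set p | (P <= p)%N]] (ball z (e / 2)).
  - by exists P => // p /= Pp; exists p.
  - by apply: nbhsx_ballx; rewrite divr_gt0.
  exists p => x rx; have := meshP p Pp; rewrite /= ltr_pdivlMr ?mulrn_wgt0//.
  rewrite mulrC => mesh_lt.
  rewrite (splitr e) (_ : z - x = (z - r p) + (r p - x)); last by rewrite addrA subrK.
  rewrite (le_lt_trans (ler_normD _ _))// ltrD//; first by rewrite -ball_normE in zp.
  exact: le_lt_trans mesh_lt.
have Hi : continuous (fun x => H x 0 i).
  by move=> x; apply: (@continuous_comp _ _ _ H (fun v : 'rV[R]_n.+1 => v 0 i) x);
    [exact: Hc|exact: coord_continuous].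
apply/eqP; rewrite eq_le; apply/andP; split; rewrite leNgt; apply/negP => hz.
- have /nbhs_ballP[e /= e0 ze] : nbhs z [set x | 0 < H x 0 i].
    exact: (Hi z) (open_nbhs_nbhs (conj (@open_gt _ 0) hz)).
  have [p near_z] := approx e e0; have [_ /(_ i)[x [_ [rx _ Hx _]]]] := rP p.
  have := ze x; rewrite -ball_normE /= => /(_ (near_z x rx)).
  by rewrite ltNge Hx.
- have /nbhs_ballP[e /= e0 ze] : nbhs z [set x | H x 0 i < 0].
    exact: (Hi z) (open_nbhs_nbhs (conj (@open_lt _ 0) hz)).
  have [p near_z] := approx e e0; have [_ /(_ i)[_ [y [_ ry _ Hy]]]] := rP p.
  have := ze y; rewrite -ball_normE /= => /(_ (near_z y ry)).
  by rewrite ltNge (ltW Hy).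
Qed.

Lemma lipschitz_continuous (R : realType) (V W : normedModType R) (g : V -> W) C :
  (forall x y, `|g x - g y| <= C * `|x - y|) -> continuous g.
Proof.
move=> gC x; apply/cvgrPdist_lt => e e0.
have D0 : 0 < `|C| + 1 by rewrite ltr_wpDl.
near=> y; apply: le_lt_trans (gC x y) _.
apply: (@le_lt_trans _ _ ((`|C| + 1) * `|x - y|)).
  by rewrite ler_wpM2r// (le_trans (ler_norm C))// lerDl.
rewrite mulrC -ltr_pdivlMr//; near: y.
apply/nbhs_ballP; exists (e / (`|C| + 1)) => [|y]; first exact: divr_gt0.
by rewrite -ball_normE.
Unshelve. all: by end_near. Qed.

(** Near [x], up to an error of smaller order, [K] is the affine map with
    derivative ['J K x].  So the rescaled map [Phi] below is uniformly near to
    the identity on the cube of radius [eta] when [t] is small, and has a zero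
    there by [poincare_miranda].  Away from [x] the derivative may vanish or
    fail to exist, so the inverse function theorem would not apply. *)
Lemma local_solvability (R : realType) (n : nat)
    (K : 'rV[R]_n.+1 -> 'rV[R]_n.+1) (x d : 'rV[R]_n.+1) (eta : R) :
  continuous K -> differentiable K x -> 'J K x \in unitmx -> 0 < eta ->
  exists2 t0, 0 < t0 & forall t, 0 < t -> t < t0 ->
    exists2 w, `|w| <= eta & K (x + t *: (d + w)) = K x + t *: (d *m 'J K x).
Proof.
move=> Kc dK Lu eta0; set L := 'J K x in Lu *.
pose C := n.+1%:R * `|invmx L|; have C0 : 0 <= C by rewrite mulr_ge0.
pose M := `|d| + eta; have M0 : 0 < M by rewrite ltr_wpDl.
(* An error of [e] per unit length becomes at most [eta / 2] after rescaling
   and applying the inverse derivative. *)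
pose e := eta / (2 * M * (C + 1)).
have e0 : 0 < e by rewrite divr_gt0// !mulr_gt0// ltr_wpDl.
have [r r0 Kr] := differentiable_expansion dK e0.
exists (r / M) => [|t t0 tr]; first by rewrite divr_gt0.
pose Phi w := (t^-1 *: (K (x + t *: (d + w)) - K x)) *m invmx L - d.
have Phi_near w : `|w| <= eta -> `|Phi w - w| <= eta / 2.
  move=> we; have dwM : `|d + w| <= M by rewrite (le_trans (ler_normD _ _))// lerD2l.
  set h := t *: (d + w).
  have hM : `|h| <= t * M by rewrite normrZ gtr0_norm// ler_pM2l.
  have hr : `|h| < r by rewrite (le_lt_trans hM)// -ltr_pdivlMr.
  have -> : Phi w - w = t^-1 *: ((K (x + h) - K x - h *m L) *m invmx L).
    rewrite mulmxBl -mulmxA mulmxV// mulmx1 scalerBr /h scalerA mulVf ?gt_eqF//.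
    by rewrite scale1r /Phi -scalemxAl opprD addrA.
  rewrite normrZ gtr0_norm ?invr_gt0//.
  rewrite mulrC ler_pdivrMr// (le_trans (norm_mulmx _ _))// -/C.
  have step1 : `|K (x + h) - K x - h *m L| <= e * (t * M).
    by rewrite (le_trans (Kr h hr))// ler_pM2l.
  apply: le_trans (_ : e * (t * M) * (C + 1) <= _).
    by rewrite ler_pM// lerDl.
  rewrite /e le_eqVlt; apply/orP; left; apply/eqP; field.
  by rewrite !gt_eqF// ltr_wpDl.
have Phi_cont : continuous Phi.
  have C1 : continuous (fun w : 'rV[R]_n.+1 => x + t *: (d + w)).
    apply: (@lipschitz_continuous _ _ _ _ t) => v w.
    rewrite opprD addrACA subrr add0r -scalerBr opprD addrACA subrr add0r.
    by rewrite normrZ gtr0_norm.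
  have C2 : continuous (fun y : 'rV[R]_n.+1 => (t^-1 *: (y - K x)) *m invmx L - d).
    apply: (@lipschitz_continuous _ _ _ _ (t^-1 * C)) => v w.
    rewrite opprB addrA subrK -mulmxBl -scalerBr opprB addrA subrK.
    rewrite (le_trans (norm_mulmx _ _))// normrZ gtr0_norm ?invr_gt0//.
    by rewrite mulrAC.
  move=> w; apply: (@continuous_comp _ _ _ (K \o (fun w : 'rV[R]_n.+1 => x + t *: (d + w)))
    (fun y : 'rV[R]_n.+1 => (t^-1 *: (y - K x)) *m invmx L - d) w); last exact: C2.
  by apply: continuous_comp; [exact: C1|exact: Kc].
have [w i we wi|w i we wi|w we Phi0] := poincare_miranda eta0 Phi_cont.
- have := le_trans (entry_le_norm (Phi w - w) 0 i) (Phi_near w we).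
  by rewrite !mxE wi ler_norml; lra.
- have := le_trans (entry_le_norm (Phi w - w) 0 i) (Phi_near w we).
  by rewrite !mxE wi ler_norml; lra.
exists w => //; move/eqP: Phi0; rewrite subr_eq0 => /eqP Phi0.
rewrite -[in RHS]Phi0 -mulmxA mulVmx// mulmx1 scalerA divff ?gt_eqF// scale1r.
by rewrite [RHS]addrC subrK.
Qed.

(** * The row norm induced by a submultiplicative norm *)

Section RowNorm.
Variables (R : realType) (n : nat) (N : 'M[R]_n.+1 -> R).
Hypothesis N_norm : submultiplicative_norm N.

(** [const_mx 1 *m v] is the square matrix all of whose rows are [v]; any fixed
    nonzero column would do to turn the matrix norm into a compatible vector
    norm. *)
Definition row_norm (v : 'rV[R]_n.+1) : R := N (const_mx 1 *m v).

Lemma row_norm_ge0 v : 0 <= row_norm v.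
Proof. exact: smn_ge0. Qed.

Lemma row_normZ a v : row_norm (a *: v) = `|a| * row_norm v.
Proof. by rewrite /row_norm -scalemxAr smn_scale. Qed.

Lemma row_norm0 : row_norm 0 = 0.
Proof. by rewrite -(scale0r (0 : 'rV_n.+1)) row_normZ normr0 mul0r. Qed.

Lemma row_norm_eq0 v : row_norm v = 0 -> v = 0.
Proof.
move=> /(smn_eq0 N_norm)/matrixP h; apply/rowP => j.
by have := h 0 j; rewrite !mxE big_ord1 mxE mul1r.
Qed.

Lemma row_normD v w : row_norm (v + w) <= row_norm v + row_norm w.
Proof. by rewrite /row_norm mulmxDr; exact: smn_triangle. Qed.

Lemma row_norm_mulmx v G : row_norm (v *m G) <= row_norm v * N G.
Proof. by rewrite /row_norm mulmxA; exact: smn_mul. Qed.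

Lemma row_norm_le : exists2 C, 0 <= C & forall v, row_norm v <= C * `|v|.
Proof.
exists (\sum_j row_norm (delta_mx 0 j)) => [|v].
  by apply: sumr_ge0 => j _; exact: row_norm_ge0.
rewrite {1}(row_sum_delta v) mulr_suml.
apply: (big_ind2 (fun x y => row_norm x <= y)) => [|x y x' y' xy xy'|j _].
- by rewrite row_norm0.
- by rewrite (le_trans (row_normD _ _))// lerD.
- by rewrite row_normZ mulrC ler_wpM2l ?row_norm_ge0// entry_le_norm.
Qed.

Lemma row_norm_dist v w : `|row_norm v - row_norm w| <= row_norm (v - w).
Proof.
have tri x y : row_norm x - row_norm y <= row_norm (x - y).
  by rewrite lerBlDr -{1}(subrK y x) row_normD.
rewrite ler_norml tri andbT lerNl opprB.
by rewrite -[X in _ <= X]mul1r -(normrN1 R) -row_normZ scaleN1r opprB tri.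
Qed.

Lemma row_norm_continuous : continuous row_norm.
Proof.
have [C _ NC] := row_norm_le; apply: (@lipschitz_continuous _ _ _ _ C) => v w.
exact: le_trans (row_norm_dist v w) (NC _).
Qed.

(** Equivalence with the sup norm, by compactness of the unit sphere. *)
Lemma row_norm_ge : exists2 c, 0 < c & forall v, c * `|v| <= row_norm v.
Proof.
pose sphere := [set v : 'rV[R]_n.+1 | `|v| = 1].
have sphere0 : sphere !=set0.
  exists (const_mx 1); apply/eqP; rewrite eq_le; apply/andP; split.
    by apply: norm_le_entries => // i j; rewrite mxE normr1.
  by have := entry_le_norm (const_mx 1 : 'rV[R]_n.+1) 0 0; rewrite mxE normr1.
have sphere_compact : compact sphere.
  apply: bounded_closed_compact.
    by exists 1; split => // x x1 v /= ->; exact: ltW.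
  exact: (closed_comp (fun x _ => @norm_continuous _ _ x) (@closed_eq R 1)).
have [w w1 wmin] := EVT_min_rV sphere0 sphere_compact
  (continuous_subspaceT row_norm_continuous).
have w1' : `|w| = 1 by exact: set_mem w1.
have c0 : 0 < row_norm w.
  rewrite lt_neqAle row_norm_ge0 andbT eq_sym; apply/eqP => /row_norm_eq0 w0.
  by move: w1'; rewrite w0 normr0 => /eqP; rewrite eq_sym oner_eq0.
exists (row_norm w) => // v; have [->|v0] := eqVneq v 0.
  by rewrite normr0 mulr0 row_norm_ge0.
have vpos : 0 < `|v| by rewrite normr_gt0.
have : row_norm w <= row_norm (`|v|^-1 *: v).
  apply: wmin; apply/mem_set; rewrite /sphere /= normrZ gtr0_norm ?invr_gt0//.
  by rewrite mulVf ?gt_eqF.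
by rewrite row_normZ gtr0_norm ?invr_gt0// mulrC ler_pdivlMr.
Qed.

Lemma row_norm_power v G k : row_norm (v *m G ^+ k) <= row_norm v * N G ^+ k.
Proof.
elim: k => [|k IH]; first by rewrite !expr0 mulmx1 mulr1.
rewrite exprSr -mulmxE mulmxA (le_trans (row_norm_mulmx _ _))//.
by rewrite exprSr mulrA ler_wpM2r// smn_ge0.
Qed.

Lemma power_decay (G : 'M[R]_n.+1) : exists D, forall k, `|G ^+ k| <= D * N G ^+ k.
Proof.
have [C C0 NC] := row_norm_le; have [c c0 Nc] := row_norm_ge.
exists (C / c) => k; have G0 : 0 <= N G ^+ k by rewrite exprn_ge0// smn_ge0.
apply: norm_le_entries => [|i j].
  by rewrite mulr_ge0// divr_ge0// ltW.
have -> : (G ^+ k) i j = ((delta_mx 0 i : 'rV_n.+1) *m G ^+ k) 0 j by rewrite -rowE [RHS]mxE.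
apply: le_trans (entry_le_norm _ _ _) _.
rewrite mulrAC ler_pdivlMr// mulrC (le_trans (Nc _))//.
rewrite (le_trans (row_norm_power _ _ _))// ler_wpM2r// (le_trans (NC _))//.
rewrite ler_piMr//; apply: norm_le_entries => // a b.
by rewrite mxE normr_nat lern1 leq_b1.
Qed.

Lemma power_mulmx_cvg0 p (u : 'M[R]_(n.+1, p)) G : N G < 1 ->
  (fun k => G ^+ k *m u) @ \oo --> (0 : 'M[R]_(n.+1, p)).
Proof.
move=> G1; have [D DG] := power_decay G; pose C := D * (n.+1%:R * `|u|).
have geo : (fun k => C * N G ^+ k) @ \oo --> (0 : R).
  rewrite -(mulr0 C); apply: cvgMl_tmp; apply: cvg_expr.
  by rewrite ger0_norm// smn_ge0.
apply/cvgrPdist_lt => e e0; near=> k; rewrite sub0r normrN.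
rewrite (le_lt_trans (norm_mulmx _ _))//.
apply: (@le_lt_trans _ _ (C * N G ^+ k)).
  by rewrite /C mulrAC ler_wpM2r// mulr_ge0.
rewrite (le_lt_trans (ler_norm _))// -normrN -sub0r.
by near: k; move/cvgrPdist_lt: geo => /(_ e e0).
Unshelve. all: by end_near. Qed.

Lemma one_minus_unit G : N G < 1 -> 1 - G \in unitmx.
Proof.
move=> G1; rewrite unitmxE unitfE; apply/negP => /det0P[v v0].
rewrite mulmxBr mulmx1 => /eqP; rewrite subr_eq0 => /eqP vG.
have := row_norm_mulmx v G; rewrite -vG leNgt gtr_pMr ?G1//.
rewrite lt_neqAle row_norm_ge0 andbT eq_sym; apply: contra v0.
by move=> /eqP/row_norm_eq0->.
Qed.

End RowNorm.

(** * Positivity of the multipliers *)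

Section Positivity.
Variables (R : realType) (n : nat).
Implicit Types (G E S : 'M[R]_n.+1) (c u : 'cV[R]_n.+1).

Lemma geometric_factor G k :
  (1 + \sum_(1 <= l < k.+1) G ^+ l) * (1 - G) = 1 - G ^+ k.+1.
Proof.
elim: k => [|k IH]; first by rewrite big_geq// addr0 mul1r expr1.
rewrite big_nat_recr//= addrA mulrDl IH mulrBr mulr1 -exprSr.
by rewrite addrA subrK.
Qed.

Lemma mxle_mulmx_col E u i : mxle 0 E -> (forall j, 0 <= u j 0) -> 0 <= (E *m u) i 0.
Proof.
move=> E0 u0; rewrite mxE sumr_ge0// => j _.
by rewrite mulr_ge0//; have := E0 i j; rewrite mxE.
Qed.

(** Iterating [u = c + E u] gives [u - E^k u >= c] for [k > 0], and [E^k u] gets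
    arbitrarily small. *)
Lemma nonneg_resolvent_pos E c u : mxle 0 E ->
  (forall e, 0 < e -> exists k, `|E ^+ k.+1 *m u| < e) ->
  (1 - E) *m u = c -> (forall i, 0 < c i 0) -> forall i, 0 < u i 0.
Proof.
move=> E0 Eu uE c0 i.
have ck k j : c j 0 <= (u - E ^+ k.+1 *m u) j 0.
  elim: k j => [|k IH] j.
    by rewrite -uE expr1 mulmxBl mul1mx.
  rewrite exprS -mulmxE -mulmxA.
  have -> : u - E *m (E ^+ k.+1 *m u) = c + E *m (u - E ^+ k.+1 *m u).
    by rewrite -uE mulmxBr mulmxBl mul1mx addrA subrK.
  rewrite mxE lerDl mxle_mulmx_col// => l.
  exact: le_trans (ltW (c0 l)) (IH l).
rewrite ltNge; apply/negP => ui.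
have [K] := Eu _ (c0 i); rewrite ltNge => /negP; apply.
apply: le_trans (ck K i) _; apply: le_trans (entry_le_norm (E ^+ K.+1 *m u) i 0).
by rewrite !mxE -normrN (le_trans _ (ler_norm _))// gerDr.
Qed.

Lemma norm_inf_row p q (A : 'M[R]_(p, q)) i : \sum_j `|A i j| <= norm_inf A.
Proof. exact: (le_bigmax _ (fun i => \sum_(j < q) `|A i j|)). Qed.

(** A zero column of [G0] would make the ratio [0 / 0 = 0], which is excluded by
    [0 <= s < min_ratio G0]. *)
Lemma min_ratio_col m (G0 : 'M[R]_(n.+1, m.+1)) s j : mxle 0 G0 -> 0 <= s ->
  s < min_ratio G0 -> s * col_max G0 j < col_min G0 j.
Proof.
move=> G0p s0 sq; have sj : s < col_min G0 j / col_max G0 j.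
  by apply: lt_le_trans sq _; apply: bigmin_le_cond.
have max0 : 0 <= col_max G0 j.
  by apply: le_trans (bigmax_ge_id _ _ _ _); have := G0p ord0 j; rewrite mxE.
have {}max0 : 0 < col_max G0 j.
  rewrite lt_neqAle max0 andbT eq_sym; apply/eqP => max_eq0.
  by move: sj; rewrite max_eq0 invr0 mulr0 ltNge s0.
by rewrite -ltr_pdivlMr.
Qed.

(** The entries of [S G0] in column [j] are at most
    [norm_inf S * col_max G0 j] in absolute value, hence smaller than
    [col_min G0 j], and adding them does not change the sign of [G0]. *)
Lemma small_perturbation_pos m S (G0 : 'M[R]_(n.+1, m.+1)) i j :
  mxle 0 G0 -> norm_inf S < min_ratio G0 -> 0 < ((1 + S) *m G0) i j.
Proof.
move=> G0p Sq; have S0 : 0 <= norm_inf S by exact: bigmax_ge_id.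
have Sj := min_ratio_col j G0p S0 Sq.
have SG : `|(S *m G0) i j| <= norm_inf S * col_max G0 j.
  rewrite mxE (le_trans (ler_norm_sum _ _ _))//.
  apply: (@le_trans _ _ (\sum_k `|S i k| * col_max G0 j)).
    apply: ler_sum => k _; rewrite normrM ler_wpM2l// ger0_norm.
      exact: (le_bigmax _ (fun i => G0 i j)).
    by have := G0p k j; rewrite mxE.
  rewrite -mulr_suml ler_wpM2r ?norm_inf_row//.
  apply: le_trans (le_bigmax _ (fun i => G0 i j) ord0).
  by have := G0p ord0 j; rewrite mxE.
have Gij : col_min G0 j <= G0 i j by exact: (bigmin_le _ i (fun i => G0 i j)).
rewrite mulmxDl mul1mx mxE.
by move: SG; rewrite ler_norml => /andP[]; lra.
Qed.

Lemma weighted_pos m (M : 'M[R]_(n.+1, m.+1)) (mu : 'rV[R]_m.+1) i :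
  mxlt 0 mu -> (forall j, 0 <= M i j) -> row i M <> 0 -> 0 < (M *m mu^T) i 0.
Proof.
move=> mu0 M0 Mi; have {}mu0 j : 0 < mu 0 j by have := mu0 0 j; rewrite mxE.
rewrite mxE lt_neqAle sumr_ge0 ?andbT => [|j _]; last by rewrite mxE mulr_ge0// ltW.
apply/negP; rewrite eq_sym psumr_eq0 => [/allP h|j _]; last by rewrite mxE mulr_ge0// ltW.
apply: Mi; apply/rowP => j; have := h j (mem_index_enum j).
by rewrite !mxE mulf_eq0 (gt_eqF (mu0 j)) orbF => /eqP.
Qed.

End Positivity.

Section Multipliers.
Variables (R : realType) (n m : nat).
Variables (f0 : 'rV[R]_n.+1 -> 'rV[R]_m.+1) (f : 'rV[R]_n.+1 -> 'rV[R]_n.+1).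
Variables (N : 'M[R]_n.+1 -> R) (N_norm : submultiplicative_norm N).

(** The Neumann series. *)
Lemma power_sum_infty (G : 'M[R]_n.+1) : N G < 1 ->
  1 + power_sum G None = invmx (1 - G).
Proof.
move=> G1; have Gu := one_minus_unit N_norm G1.
have sumE k : \sum_(1 <= l < k.+1) G ^+ l = invmx (1 - G) - 1 - G ^+ k.+1 *m invmx (1 - G).
  have := geometric_factor G k; rewrite -mulmxE => /(congr1 (mulmx^~ (invmx (1 - G)))).
  rewrite -mulmxA mulmxV// mulmx1 mulmxBl mul1mx => /(canRL (addKr _)) ->.
  by rewrite addrC addrAC.
suff -> : power_sum G None = invmx (1 - G) - 1 by rewrite addrC subrK.
apply: cvg_lim; first exact: norm_hausdorff.
rewrite -(cvg_shiftS (fun K => \sum_(1 <= l < K) G ^+ l)) /=.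
under eq_cvg do rewrite sumE.
have tail0 : (fun k => G ^+ k.+1 *m invmx (1 - G)) @ \oo --> (0 : 'M[R]_n.+1).
  have := power_mulmx_cvg0 N_norm (invmx (1 - G)) G1.
  by rewrite -(cvg_shiftS (fun k => G ^+ k *m invmx (1 - G))).
by have := cvgB (cvg_cst (invmx (1 - G) - 1)) tail0; rewrite subr0; apply.
Qed.

(** For finite [k], multiplying [(1 - G) u = G0 mu^T] by [1 + S] gives
    [(1 - G^k) u = (1 + S) G0 mu^T], a positive vector, and [G^k] is nonnegative
    with powers tending to zero.  For infinite [k], [(1 - G)^-1] itself is
    [1 + S]. *)
Lemma multiplier_pos x (mu : 'rV[R]_m.+1) (u : 'cV[R]_n.+1) :
  qualifying_condition f0 f N x -> mxlt 0 mu ->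
  (1 - gradient f x) *m u = gradient f0 x *m mu^T -> forall i, 0 < u i 0.
Proof.
move=> [[G0_ge0 G0_row] NG [k [k1 k_nonneg k_sum]]] mu0.
set G := gradient f x in NG k_nonneg k_sum *.
set G0 := gradient f0 x in G0_ge0 G0_row k_sum *.
move=> uE; have dominant S : norm_inf S < min_ratio G0 ->
    forall i, 0 < ((1 + S) *m (G0 *m mu^T)) i 0.
  move=> Sq i; have pos j := small_perturbation_pos i j G0_ge0 Sq.
  rewrite mulmxA; apply: weighted_pos => // [j|]; first exact: ltW.
  by move=> /rowP/(_ ord0); rewrite !mxE => Mi; have := pos ord0; rewrite mxE Mi ltxx.
case: k => [[//|k]|] in k1 k_nonneg k_sum *; last first.
  have := dominant _ (k_sum isT); rewrite (power_sum_infty NG) -uE mulmxA.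
  by rewrite mulVmx ?mul1mx// (one_minus_unit N_norm).
apply: (nonneg_resolvent_pos (k_nonneg k.+1 erefl)).
- move=> e e0; move/cvgrPdist_lt: (power_mulmx_cvg0 N_norm u NG) => /(_ e e0)[K _ HK].
  exists K; rewrite -exprM; have := HK (k.+1 * K.+1)%N; rewrite sub0r normrN; apply.
  by rewrite /= mulSn; lia.
- by rewrite -(geometric_factor G k) -mulmxE -mulmxA uE.
- case: k => [|k] in k1 k_nonneg k_sum *; last exact: dominant (k_sum isT).
  move=> i; rewrite big_geq// addr0 mul1mx; apply: weighted_pos => // j.
  by have := G0_ge0 i j; rewrite mxE.
Qed.

End Multipliers.

(** * Weighted maximizers and fixed points *)

Lemma jacobian_idB (R : realType) n (f : 'rV[R]_n -> 'rV[R]_n) x :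
  differentiable f x ->
  differentiable (fun y => y - f y) x /\
  'J (fun y => y - f y) x = 1%:M - gradient f x.
Proof.
move=> fx; have idx : differentiable (id : 'rV[R]_n -> 'rV[R]_n) x by [].
have did : 'd (id : 'rV[R]_n -> 'rV[R]_n) x = id :> (_ -> _).
  by rewrite (@diff_lin _ _ _ idfun) // => ?.
split; first exact: (differentiableB idx fx).
rewrite (gradientE fx); apply/row_matrixP => i; rewrite !rowE mulmxBr mulmx1.
have JfE v : v *m 'J f x = 'd f x v by rewrite mul_rV_lin1.
have JKE v : v *m 'J (fun y => y - f y) x = 'd (id - f) x v by rewrite mul_rV_lin1.
apply: etrans (JKE _) (etrans _ (congr1 (fun z => _ - z) (esym (JfE _)))).
apply: etrans (congr1 (fun g => g (delta_mx 0 i)) (diffB idx fx)) _.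
exact: (congr1 (fun g => g (delta_mx 0 i) - _) did).
Qed.

Section FixedPoints.
Variables (R : realType) (n m : nat).
Variables (f0 : 'rV[R]_n.+1 -> 'rV[R]_m.+1) (f : 'rV[R]_n.+1 -> 'rV[R]_n.+1).
Variables (N : 'M[R]_n.+1 -> R) (N_norm : submultiplicative_norm N).
Hypothesis f_diff : forall x : 'rV[R]_n.+1, differentiable f x.

Lemma weighted_objectiveE mu x : weighted_objective f0 mu x = (f0 x *m mu^T) 0 0.
Proof. by rewrite /weighted_objective mxE; apply: eq_bigr => j _; rewrite mxE mulrC. Qed.

(** A positive multiplier of a slack constraint yields a better feasible point.
    The point is sought as [x + t (d + w)] with [w] small, so that [K = id - f]
    increases by exactly [t e_i]: slack [i] drops by [t] and the other slacks,
    in particular those of the equality constraints, do not change. *)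
Lemma slack_not_maximal (A : {set 'I_n.+1}) mu x i :
  differentiable f0 x -> 1 - gradient f x \in unitmx ->
  0 < (invmx (1 - gradient f x) *m (gradient f0 x *m mu^T)) i 0 ->
  feasible f A (~: A) x -> x 0 i < f x 0 i ->
  ~ weighted_maximizer f0 f A (~: A) mu x.
Proof.
move=> f0x Lu; have [dK JK] := jacobian_idB (f_diff x).
set K := fun y => y - f y in dK JK; set L := 1 - gradient f x in Lu *.
set c := gradient f0 x *m mu^T; set ui := (_ *m c) i 0 => ui0 [xA xB] xi [_ xmax].
pose d : 'rV[R]_n.+1 := delta_mx 0 i *m invmx L.
have dc : (d *m c) 0 0 = ui by rewrite /d -mulmxA -rowE mxE.
have dL : d *m L = delta_mx 0 i by rewrite /d -mulmxA mulVmx// mulmx1.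
pose Cc := n.+1%:R * `|c|; have Cc0 : 0 <= Cc by rewrite mulr_ge0.
pose Cmu := m.+1%:R * `|mu^T|; have Cmu0 : 0 <= Cmu by rewrite mulr_ge0.
(* The gain is [t * ui] to first order; the correction [w] and the remainder of
   [f0] may each cost a quarter of it. *)
pose eta := ui / 4 / (Cc + 1).
have eta0 : 0 < eta by rewrite !divr_gt0// ltr_wpDl.
pose M := `|d| + eta; have M0 : 0 < M by rewrite ltr_wpDl.
pose e := ui / 4 / (M * (Cmu + 1)).
have e0 : 0 < e by rewrite !divr_gt0// mulr_gt0// ltr_wpDl.
have Kc : continuous K.
  move=> y; apply: differentiable_continuous.
  by case: (jacobian_idB (f_diff y)).
have Ku : 'J K x \in unitmx by rewrite JK.
have [t0 t0_gt0 solve] := local_solvability d Kc dK Ku eta0.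
have [r r0 f0r] := differentiable_expansion f0x e0.
pose bound := Num.min t0 (Num.min (r / M) (f x 0 i - x 0 i)).
have bound0 : 0 < bound by rewrite !lt_min t0_gt0 divr_gt0//= subr_gt0.
pose t := bound / 2; have t_gt0 : 0 < t by rewrite divr_gt0.
have : t < bound by rewrite ltr_pdivrMr// ltr_pMr// ltr1n.
rewrite !lt_min => /and3P[tt0 tr ts].
have [w we Kw] := solve t t_gt0 tt0; set h := t *: (d + w) in Kw.
have hM : `|h| <= t * M.
  by rewrite normrZ gtr0_norm// ler_pM2l// (le_trans (ler_normD _ _))// lerD2l.
have hr : `|h| < r by rewrite (le_lt_trans hM)// -ltr_pdivlMr.
have slack j : f (x + h) 0 j - (x + h) 0 j = f x 0 j - x 0 j - t * (j == i)%:R.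
  move/rowP/(_ j): Kw; rewrite JK dL /K !mxE eqxx /= => Kwj.
  by lra.
have yfeas : feasible f A (~: A) (x + h).
  split=> j jA; have := slack j.
    by have := xA j jA; case: eqVneq => [->|_]; rewrite ?mulr1 ?mulr0; lra.
  rewrite (xB j jA); case: eqVneq => [ji|_]; last by rewrite mulr0; lra.
  by have := xB j jA; rewrite ji; lra.
have := xmax _ yfeas; rewrite !weighted_objectiveE leNgt => /negP; apply.
pose err := f0 (x + h) - f0 x - h *m 'J f0 x.
have gain : ((f0 (x + h) - f0 x) *m mu^T) 0 0 =
    t * (ui + (w *m c) 0 0) + (err *m mu^T) 0 0.
  have -> : f0 (x + h) - f0 x = t *: ((d + w) *m gradient f0 x) + err.
    by rewrite scalemxAl -/h gradientE// [RHS]addrC subrK.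
  rewrite mulmxDl -scalemxAl -mulmxA -/c mulmxDl -dc.
  rewrite [LHS]mxE; congr (_ + _); rewrite [LHS]mxE; congr (_ * _).
  by rewrite [LHS]mxE.
have wc : `|(w *m c) 0 0| <= ui / 4.
  rewrite (le_trans (entry_le_norm _ _ _))// (le_trans (norm_mulmx _ _))// -/Cc.
  apply: (@le_trans _ _ (eta * (Cc + 1))); first by rewrite ler_pM// lerDl.
  by rewrite divfK// gt_eqF// ltr_wpDl.
have errmu : `|(err *m mu^T) 0 0| <= t * (ui / 4).
  rewrite (le_trans (entry_le_norm _ _ _))// (le_trans (norm_mulmx _ _))// -/Cmu.
  apply: (@le_trans _ _ (e * (t * M) * (Cmu + 1))).
    rewrite ler_pM// ?lerDl// (le_trans (f0r h hr))// ler_pM2l//.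
  rewrite (_ : e * (t * M) * (Cmu + 1) = t * (e * (M * (Cmu + 1)))); last by ring.
  by rewrite divfK// gt_eqF// mulr_gt0// ltr_wpDl.
have : 0 < t * (ui + (w *m c) 0 0) + (err *m mu^T) 0 0.
  move: wc errmu; rewrite !ler_norml => /andP[wc _] /andP[errmu _].
  have : t * (ui + - (ui / 4)) <= t * (ui + (w *m c) 0 0) by rewrite ler_pM2l// lerD2l.
  have : 0 < t * ui by rewrite mulr_gt0.
  by lra.
by rewrite -gain mulmxBl !mxE subr_gt0.
Qed.

Lemma maximizer_fixed (A : {set 'I_n.+1}) mu x :
  differentiable f0 x -> qualifying_condition f0 f N x -> mxlt 0 mu ->
  weighted_maximizer f0 f A (~: A) mu x -> x = f x.
Proof.
move=> f0x qx mu0 xmax; have [xfeas _] := xmax; have [xA xB] := xfeas.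
have Lu : 1 - gradient f x \in unitmx by case: qx => _ NG _; exact: one_minus_unit NG.
apply/rowP => i; have [iA|iA] := boolP (i \in A); last by apply: xB; rewrite inE.
apply/eqP; rewrite eq_le xA//= leNgt; apply/negP => xi.
apply: slack_not_maximal xfeas xi xmax => //.
by apply: multiplier_pos mu0 _ _ => //; [exact: N_norm|exact: qx|rewrite mulKVmx].
Qed.

(** The radius depends on [x]: the norms of the gradients need not be bounded
    away from 1, so no uniform contraction is to be expected. *)
Lemma local_contraction x h : N (gradient f x) < 1 -> h != 0 ->
  exists2 r, 0 < r & forall t, 0 < t -> t < r ->
    row_norm N (f (x + t *: h) - f x) < t * row_norm N h.
Proof.
move=> NG h0; set G := gradient f x in NG.
have h_gt0 : 0 < row_norm N h.
  rewrite lt_neqAle row_norm_ge0// andbT eq_sym; apply: contra h0 => /eqP.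
  by move/(row_norm_eq0 N_norm)->.
have [C C0 NC] := row_norm_le N_norm.
pose e := row_norm N h * (1 - N G) / (C * `|h| + 1).
have D0 : 0 < C * `|h| + 1 by rewrite ltr_wpDl// mulr_ge0.
have e0 : 0 < e by rewrite divr_gt0// mulr_gt0// subr_gt0.
have hn0 : 0 < `|h| by rewrite normr_gt0.
have [r r0 fr] := differentiable_expansion (f_diff x) e0.
exists (r / `|h|) => [|t t0 tr]; first by rewrite divr_gt0.
have th : `|t *: h| = t * `|h| by rewrite normrZ gtr0_norm.
have thr : `|t *: h| < r by rewrite th -ltr_pdivlMr.
have := fr _ thr; rewrite -gradientE// -/G; set err := _ - _ *m G => err_le.
rewrite -(subrK (t *: h *m G) (f _ - f x)) -/err.
rewrite (le_lt_trans (row_normD N_norm _ _))//.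
have lin : row_norm N (t *: h *m G) <= t * (row_norm N h * N G).
  by rewrite -scalemxAl row_normZ// gtr0_norm// ler_pM2l// row_norm_mulmx.
have small : row_norm N err < t * (row_norm N h * (1 - N G)).
  rewrite (le_lt_trans (NC _))//.
  apply: (@le_lt_trans _ _ (C * (e * (t * `|h|)))); first by rewrite ler_wpM2l// -th.
  rewrite (_ : C * _ = t * (e * (C * `|h|))); last by ring.
  by rewrite ltr_pM2l// {1}/e -mulrA gtr_pMr ?mulr_gt0 ?subr_gt0// mulrC ltr_pdivrMr// mul1r ltrDl.
by rewrite mulrBr mulr1 in small; lra.
Qed.

(** Along the segment from [x] to [y] consider how far [f] has moved, in the row
    norm, minus how far the argument has moved.  At both ends this is zero, as
    [x] and [y] are fixed; but by [local_contraction] it drops immediately to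
    the right of each point before the end.  So its minimum would be negative,
    attained before the end, and not a minimum.  This avoids a mean value
    theorem for a norm that is not given by coordinates. *)
Lemma fixed_point_unique x y :
  (forall t, 0 <= t <= 1 -> N (gradient f (x + t *: (y - x))) < 1) ->
  x = f x -> y = f y -> x = y.
Proof.
move=> NG fx fy; apply: contrapT => /eqP xy; pose h := y - x.
have h0 : h != 0 by rewrite subr_eq0 eq_sym.
pose phi t := row_norm N (f (x + t *: h) - f x) - t * row_norm N h.
have phi0 : phi 0 = 0 by rewrite /phi scale0r addr0 subrr row_norm0// mul0r subrr.
have phi1 : phi 1 = 0.
  have xh : x + h = y by rewrite addrC subrK.
  by rewrite /phi scale1r xh -fx -fy mul1r subrr.
have phi_drop t : 0 <= t -> t < 1 -> exists2 s, t < s <= 1 & phi s < phi t.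
  move=> t0 t1; have [|r r0 rP] := local_contraction (x := x + t *: h) _ h0.
    by apply: NG; rewrite t0 ltW.
  pose q := Num.min r (1 - t) / 2.
  have b0 : 0 < Num.min r (1 - t) by rewrite lt_min r0 subr_gt0.
  have q0 : 0 < q by rewrite divr_gt0.
  have : q < Num.min r (1 - t) by rewrite ltr_pdivrMr// ltr_pMr// ltr1n.
  rewrite lt_min => /andP[qr q1].
  exists (t + q); first by apply/andP; split; lra.
  have := rP q q0 qr; rewrite -addrA -scalerDl /phi => drop.
  have := row_normD N_norm (f (x + (t + q) *: h) - f (x + t *: h)) (f (x + t *: h) - f x).
  by rewrite addrA subrK mulrDl; lra.
have phi_cont : continuous phi.
  have line_cont : continuous (fun t : R => x + t *: h).
    apply: (@lipschitz_continuous _ _ _ _ `|h|) => s t.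
    by rewrite opprD addrACA subrr add0r -scalerBl normrZ mulrC.
  have diff_cont : continuous (fun z => row_norm N (f z - f x)).
    move=> z; apply: (@continuous_comp _ _ _ (fun z => f z - f x) (row_norm N)).
      apply: continuousB; last exact: cst_continuous.
      by apply: differentiable_continuous; exact: f_diff.
    exact: row_norm_continuous.
  have comp_cont : continuous (fun t : R => row_norm N (f (x + t *: h) - f x)).
    move=> t; apply: (@continuous_comp _ _ _ (fun t : R => x + t *: h)
      (fun z => row_norm N (f z - f x)) t); first exact: line_cont.
    exact: diff_cont.
  move=> t; exact: (continuousB (comp_cont t) (@mulrr_continuous R (row_norm N h) t)).
have [c /itvP c01 cmin] := EVT_min (@ler01 R) (continuous_subspaceT phi_cont).
have [c1|c1] := ltP c 1.
  have [|s /andP[cs s1]] := phi_drop c _ c1; first by rewrite c01.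
  by rewrite ltNge cmin// in_itv /= s1 (le_trans _ (ltW cs))// c01.
have ceq : c = 1 by apply/eqP; rewrite eq_le c1 andbT c01.
have [//||s /andP[s0 s1]] := phi_drop 0; first exact: ltr01.
by rewrite phi0 -phi1 -ceq ltNge cmin// in_itv /= s1 (ltW s0).
Qed.

End FixedPoints.

(** * Pareto optimality *)

Lemma box_segment (R : realType) n (a b x y : 'rV[R]_n.+1) t :
  box a b x -> box a b y -> 0 <= t <= 1 -> box a b (x + t *: (y - x)).
Proof.
move=> [ax xb] [ay yb] /andP[t0 t1]; split=> i j; rewrite !mxE.
  have := ax i j; have := ay i j; nra.
have := xb i j; have := yb i j; nra.
Qed.

(** If [f0 x] exceeded [f0 y] in coordinate [j], giving [j] a weight large
    enough to outdo all other coordinates would make [x] better. *)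
Lemma dominated_of_weighted (R : realType) (n m : nat)
    (f0 : 'rV[R]_n.+1 -> 'rV[R]_m.+1) x y :
  (forall mu, mxlt 0 mu -> weighted_objective f0 mu x <= weighted_objective f0 mu y) ->
  mxle (f0 x) (f0 y).
Proof.
move=> wle i j; rewrite ord1 leNgt; apply/negP => yx.
pose gap := f0 x 0 j - f0 y 0 j; have gap0 : 0 < gap by rewrite subr_gt0.
pose D := \sum_k `|f0 y 0 k - f0 x 0 k|; have D0 : 0 <= D by exact: sumr_ge0.
pose mu : 'rV[R]_m.+1 := \row_k (1 + (D + 1) / gap * (k == j)%:R).
have w0 : 0 < (D + 1) / gap by rewrite divr_gt0// ltr_wpDl.
have mu0 : mxlt 0 mu.
  by move=> a k; rewrite !mxE ltr_wpDr// mulr_ge0// ltW.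
have := wle mu mu0; rewrite leNgt => /negP; apply.
rewrite -subr_gt0 /weighted_objective -sumrB.
have -> : \sum_k (mu 0 k * f0 x 0 k - mu 0 k * f0 y 0 k) =
    \sum_k (f0 x 0 k - f0 y 0 k) + (D + 1).
  under eq_bigr => k _ do rewrite mxE -mulrBr mulrDl mul1r.
  rewrite big_split /=; congr (_ + _); rewrite (bigD1 j)//= big1 => [|k kj].
    by rewrite eqxx mulr1 addr0 divfK// gt_eqF.
  by rewrite (negbTE kj) mulr0 mul0r.
have : - D <= \sum_k (f0 x 0 k - f0 y 0 k).
  rewrite lerNl -sumrN; apply: ler_sum => k _; rewrite opprB; exact: ler_norm.
by lra.
Qed.

Theorem theorem7 (R : realType) (n m : nat)
    (f0 : 'rV[R]_n.+1 -> 'rV[R]_m.+1) (f : 'rV[R]_n.+1 -> 'rV[R]_n.+1)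
    (A B : {set 'I_n.+1}) (a b : 'rV[R]_n.+1)
    (f0_diff : forall x : 'rV[R]_n.+1, differentiable f0 x)
    (f_diff : forall x : 'rV[R]_n.+1, differentiable f x)
    (AB_compl : B = ~: A)
    (f_box : forall x, box a b x -> box a b (f x))
    (candidates : box_contains_candidates f0 f A B a b)
    (feas : exists x, feasible f A B x)
    (N : 'M[R]_n.+1 -> R) (N_norm : submultiplicative_norm N)
    (gqc : forall x, box a b x -> qualifying_condition f0 f N x) :
  fast_lipschitz f0 f A B a b.
Proof.
subst B.
have unique x y : box a b x -> box a b y -> x = f x -> y = f y -> x = y.
  move=> xD yD; apply: (fixed_point_unique N_norm f_diff) => t t01.
  by have [] := gqc _ (box_segment xD yD t01).
have maximizer mu x : mxlt 0 mu -> weighted_maximizer f0 f A (~: A) mu x ->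
    box a b x /\ x = f x.
  move=> mu0 xmax; have xD := (candidates mu mu0).2 x xmax; split=> //.
  exact: (maximizer_fixed N_norm f_diff (f0_diff x) (gqc x xD) mu0 xmax).
pose ones : 'rV[R]_m.+1 := const_mx 1.
have ones0 : mxlt 0 ones by move=> i j; rewrite !mxE.
have [xs xs_max] := (candidates ones ones0).1.
have [xsD xsf] := maximizer _ _ ones0 xs_max.
have xs_best mu : mxlt 0 mu -> weighted_maximizer f0 f A (~: A) mu xs.
  move=> mu0; have [z zmax] := (candidates mu mu0).1.
  have [zD zf] := maximizer _ _ mu0 zmax.
  by rewrite (unique xs z).
have xs_dom x : feasible f A (~: A) x -> mxle (f0 x) (f0 xs).
  by move=> xfeas; apply: dominated_of_weighted => mu /xs_best[_]; apply.
have xs_feas := xs_max.1.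
exists xs; split=> //.
- split=> // -[x [xfeas xxs f0x]]; apply: xxs.
  suff [xD xf] : box a b x /\ x = f x by exact: unique.
  apply: (maximizer ones) => //; split=> // y /xs_max.2 yxs.
  apply: le_trans yxs _; apply: ler_sum => j _.
  by rewrite ler_wpM2l ?mxE.
- move=> x [xfeas x_opt]; apply: contrapT => xxs; apply: x_opt.
  by exists xs; split; [exact: xs_feas|move=> h; apply: xxs|exact: xs_dom].
- by move=> x xD xf; exact: unique.
Qed.
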